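(* Let $G$ be a connected $k$-regular graph with $n$ vertices and $m$ edges. Let $G_1$ and $G_2$ be two arbitrary graphs with $n_1$ and $n_2$ vertices, respectively. Then the Laplacian spectrum of the $R$-graph double join $G^R\vee(G_1^\bullet,G_2^\circ)$ consists of: (i) $\lambda_i(G_1)+n$, for $i=2,3,\ldots,n_1$; (ii) $\lambda_i(G_2)+m$, for $i=2,3,\ldots,n_2$; (iii) $\dfrac{(n_1+\lambda_i(G)+k+n_2+2)\pm\sqrt{(n_1+\lambda_i(G)+k-n_2-2)^2+4(2k-\lambda_i(G))}}{2}$, for $i=2,3,\ldots,n$; (iv) $n_2+2$, repeated $m-n$ times; (v) the four roots of the equation $$\begin{aligned}\lambda\bigl(&\lambda^3-(m+n+n_1+k+n_2+2)\lambda^2+(2m+(n_1+k+n)(m+n_2+2)+nk-2k)\lambda\\&+2(n+m)k-2(n_1+k+n)m-nk(m+n_2+2)\bigr)=0.\end{aligned}$$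
   Context: All graphs are finite and simple. The Laplacian matrix of a graph $H$ is $L(H)=D(H)-A(H)$, where $A(H)$ is the adjacency matrix and $D(H)$ the diagonal matrix of vertex degrees. The Laplacian spectrum of $H$ consists of all eigenvalues of $L(H)$; if $H$ has $N$ vertices they are written $\lambda_1(H)\le\lambda_2(H)\le\cdots\le\lambda_N(H)$. For a connected graph $G$, the $R$-graph $R(G)$ is obtained from $G$ (keeping all edges of $G$) by adding a new vertex corresponding to each edge of $G$ and adding edges between each added vertex and the two endpoints of the corresponding edge; let $I(G)$ be the set of added new vertices. The $R$-graph double join $G^R\vee(G_1^\bullet,G_2^\circ)$ is the graph obtained from $R(G)$, $G_1$ and $G_2$ by joining every vertex of $G$ (as an original vertex of $R(G)$) to every vertex of $G_1$ and every vertex of $I(G)$ to every vertex of $G_2$. *)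

(* Defs.v *)
From mathcomp Require Import all_boot all_order all_algebra.
From mathcomp Require Import polyrcf.

Set Implicit Arguments.
Unset Strict Implicit.
Unset Printing Implicit Defensive.

Import Order.TTheory GRing.Theory Num.Theory.

Record sgraph := SGraph {
  svertex :> finType;
  sedge : rel svertex;
  sedge_sym : symmetric sedge;
  sedge_irr : irreflexive sedge
}.

Section Graphs.
Implicit Types G H : sgraph.

Definition degree H (x : H) : nat := #|[set y : H | sedge x y]|.

Definition regular H (k : nat) : Prop := forall x : H, degree x = k.

Definition connected H : Prop :=
  0 < #|H| /\ forall x y : H, connect (@sedge H) x y.

Definition edges H : {set {set H}} :=
  [set [set p.1; p.2] | p : H * H & sedge p.1 p.2].

Definition edge_type H : finType := {A : {set H} | A \in edges H}.

Definition Rrel G (u v : G + edge_type G) : bool :=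
  match u, v with
  | inl x, inl y => sedge x y
  | inl x, inr A => x \in val A
  | inr A, inl x => x \in val A
  | inr _, inr _ => false
  end.

Lemma Rrel_sym G : symmetric (@Rrel G).
Proof. by move=> [x|A] [y|B] //=; rewrite sedge_sym. Qed.

Lemma Rrel_irr G : irreflexive (@Rrel G).
Proof. by move=> [x|A] //=; rewrite sedge_irr. Qed.

Definition Rgraph G : sgraph := SGraph (@Rrel_sym G) (@Rrel_irr G).

(* In [Rgraph G], [inl] gives the original vertices and [inr] those of I(G). *)
Definition Rjoin_rel G G1 G2 (u v : Rgraph G + (G1 + G2)) : bool :=
  match u, v with
  | inl x, inl y => sedge x y
  | inr (inl x), inr (inl y) => sedge x y
  | inr (inr x), inr (inr y) => sedge x y
  | inl (inl _), inr (inl _) | inr (inl _), inl (inl _) => true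
  | inl (inr _), inr (inr _) | inr (inr _), inl (inr _) => true
  | _, _ => false
  end.

Lemma Rjoin_rel_sym G G1 G2 : symmetric (@Rjoin_rel G G1 G2).
Proof.
by move=> [[x|x]|[x|x]] [[y|y]|[y|y]] //=; rewrite ?[Rrel _ _]Rrel_sym // sedge_sym.
Qed.

Lemma Rjoin_rel_irr G G1 G2 : irreflexive (@Rjoin_rel G G1 G2).
Proof. by move=> [[x|x]|[x|x]] //=; rewrite sedge_irr. Qed.

Definition Rgraph_double_join G G1 G2 : sgraph :=
  SGraph (@Rjoin_rel_sym G G1 G2) (@Rjoin_rel_irr G G1 G2).

End Graphs.

Local Open Scope ring_scope.

Section Spectrum.
Variable R : rcfType.

(* The real eigenvalues of A in nondecreasing order, each one repeated
   according to its multiplicity as a root of the characteristic polynomial;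
   for a symmetric A these are all the eigenvalues. *)
Definition spectrum N (A : 'M[R]_N) : seq R :=
  let p := char_poly A in
  sort <=%R (flatten [seq nseq (mup x p) x | x <- rootsR p]).

Variable H : sgraph.

Definition adjacency_mx : 'M[R]_#|H| :=
  \matrix_(i, j) (sedge (enum_val i) (enum_val j))%:R.

Definition degree_mx : 'M[R]_#|H| :=
  diag_mx (\row_i (degree (enum_val i))%:R).

Definition laplacian : 'M[R]_#|H| := degree_mx - adjacency_mx.

Definition lap_spectrum : seq R := spectrum laplacian.

(* Indexed from 1, so that [lap_eig 1] is the smallest eigenvalue. *)
Definition lap_eig (i : nat) : R := nth 0 lap_spectrum i.-1.

End Spectrum.

(* Main.v *)
(** For [x] beyond an explicit bound, [det (x - L)] of the double join is computed
    by Schur complements, eliminating first [G1] and [G2], then I(G).  Every block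
    to be inverted is of the form Laplacian pencil or scalar matrix minus a multiple
    of the all-ones matrix, and it only has to be inverted against constant vectors
    or the incidence matrix [B], so that constant row sums suffice.  Since
    [B B^T = k I + A = 2 k I - L(G)], what remains on [G] is a pencil of [L(G)] plus a
    constant matrix, whence one quadratic factor for each of
    [lambda_2(G), ..., lambda_n(G)]; the factors belonging to the constant vectors combine into
    the quartic, using the handshake identity [n k = 2 m].  Both sides are
    polynomials in [x], so they agree; real symmetric matrices have split
    characteristic polynomials, and the multisets of roots are compared. *)

Require Import Defs.
From mathcomp Require Import all_boot all_order all_algebra.
From mathcomp Require Import perm polyrcf complex ring lra zify.

Set Implicit Arguments.
Unset Strict Implicit.
Unset Printing Implicit Defensive.

Import Order.TTheory GRing.Theory Num.Theory.
Local Open Scope ring_scope.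

(** * Spectra of real symmetric matrices *)

Lemma char_poly_conj (F : fieldType) N (P A : 'M[F]_N) :
  P \in unitmx -> char_poly (invmx P *m A *m P) = char_poly A.
Proof.
move=> Pu; rewrite /char_poly /char_poly_mx.
have Pu' : map_mx (@polyC F) P \in unitmx by rewrite map_unitmx.
rewrite -[RHS]mul1r -(det1 _ N) -(mulVmx Pu') det_mulmx mulrAC -!det_mulmx.
congr (\det _).
by rewrite mulmxBr mulmxBl !map_mxM map_invmx scalar_mxC mulmxKV.
Qed.

(** [rootsR] lists distinct roots, so only the block of [x] contributes to its count; the length of
    that block is the multiplicity of [x] in the product. *)
Lemma perm_spectrum (R : rcfType) N (A : 'M[R]_N) (s : seq R) :
  char_poly A = \prod_(x <- s) ('X - x%:P) -> perm_eq (spectrum A) s.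
Proof.
move=> As; rewrite /spectrum As perm_sort.
apply/allP=> x _ /=; apply/eqP.
rewrite count_flatten -map_comp.
set rs := rootsR _.
have rsE y : (y \in rs) = (y \in s).
  rewrite -[LHS]roots_on_rootsR ?monic_neq0 ?monic_prod_XsubC //.
  by rewrite root_prod_XsubC.
have urs : uniq rs by apply: uniq_roots.
rewrite sumnE big_map.
under eq_bigr do rewrite /= count_nseq mu_prod_XsubC /=.
have [xs|xs] := boolP (x \in rs).
  rewrite (bigD1_seq x) //= eqxx mul1n big1 ?addn0 // => y /negPf.
  by move=> ->.
rewrite big1_seq; first by move: xs; rewrite rsE => /count_memPn ->.
move=> y /andP [_ ys]; case: eqP => [yx|//]; by rewrite -yx ys in xs.
Qed.

(** Over [R[i]] the matrix is Hermitian, hence unitarily diagonalizable with real diagonal; the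
    factorization then descends to [R] because the embedding is injective. *)
Lemma char_poly_symmetric (R : rcfType) N (A : 'M[R]_N) :
  A^T = A -> char_poly A = \prod_(x <- spectrum A) ('X - x%:P).
Proof.
move=> symA.
pose f := real_complex R.
pose B := map_mx f A.
have hB : B \is hermsymmx.
  apply/is_hermitianmxP; rewrite expr0 scale1r.
  apply/matrixP=> i j; rewrite !mxE -[in RHS]symA mxE.
  by apply/esym/CrealP/complex_realP; exists (A i j).
have /orthomx_spectralP BE := hermitian_normalmx hB.
have rD := hermitian_spectral_diag_real hB.
pose s := [seq complex.Re (spectral_diag B 0 i) | i <- enum 'I_N].
suff As : char_poly A = \prod_(x <- s) ('X - x%:P).
  by rewrite {1}As; apply: perm_big; rewrite perm_sym; apply: perm_spectrum.
apply: (map_inj_poly (@complexI R)); first by [].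
rewrite [LHS]map_char_poly.
rewrite [map_mx _ _]BE char_poly_conj ?spectral_unit //.
rewrite char_poly_trig ?diag_mx_is_trig // map_prod_XsubC.
rewrite big_map big_enum /=; apply: eq_bigr => i _.
by rewrite !mxE eqxx mulr1n RRe_real //; move/mxOverP: rD.
Qed.

(** * Determinants indexed by finite types *)

(** Indexing by finite types lets blocks be given by pattern matching on sum types. *)
Definition fmx (R : Type) (S T : finType) (f : S -> T -> R) : 'M[R]_(#|S|, #|T|) :=
  \matrix_(i, j) f (enum_val i) (enum_val j).

Definition fdet (R : comPzRingType) (T : finType) (f : T -> T -> R) : R :=
  \det (fmx f).

Section IndexedDeterminant.
Variable R : comPzRingType.

Lemma eq_fdet (T : finType) (f g : T -> T -> R) : f =2 g -> fdet f = fdet g.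
Proof. by move=> fg; congr (\det _); apply/matrixP=> i j; rewrite !mxE fg. Qed.

(** Two enumerations differ by a permutation of both rows and columns, so its sign occurs twice and
    cancels. *)
Lemma fdetE (T : finType) N (e : 'I_N -> T) (f : T -> T -> R) :
  bijective e -> fdet f = \det (\matrix_(i, j) f (e i) (e j)).
Proof.
move=> bij_e; have NT : N = #|T| by rewrite -(bij_eq_card bij_e) card_ord.
subst N.
have inj_s : injective (enum_rank \o e).
  by apply: inj_comp; [exact: enum_rank_inj | exact: bij_inj].
pose s := perm inj_s.
have -> : \matrix_(i, j) f (e i) (e j) = row_perm s (col_perm s (fmx f)).
  by apply/matrixP=> i j; rewrite !mxE !permE /= !enum_rankK.
rewrite row_permE col_permE !det_mulmx !det_perm odd_permV.
by rewrite mulrC -mulrA -signr_addb addbb mulr1.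
Qed.

Lemma fdet_reindex (S T : finType) (h : S -> T) (f : T -> T -> R) :
  bijective h -> fdet (fun x y => f (h x) (h y)) = fdet f.
Proof.
move=> bij_h; rewrite [RHS](@fdetE _ #|S| (fun i => h (enum_val i))) //.
exact: (bij_comp bij_h (@enum_val_bij S)).
Qed.

Lemma fdet_unit (f : unit -> unit -> R) : fdet f = f tt tt.
Proof.
rewrite (@fdetE _ 1 (fun=> tt)) ?det_mx11 ?mxE //.
by exists (fun=> 0) => [i|[]]; rewrite ?ord1.
Qed.

Lemma fdet_sum (S T : finType) (f : S + T -> S + T -> R) :
  fdet f = \det (block_mx (fmx (fun x y => f (inl x) (inl y)))
                          (fmx (fun x y => f (inl x) (inr y)))
                          (fmx (fun x y => f (inr x) (inl y)))
                          (fmx (fun x y => f (inr x) (inr y)))).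
Proof.
pose e (i : 'I_(#|S| + #|T|)) : S + T :=
  match split i with inl j => inl (enum_val j) | inr j => inr (enum_val j) end.
pose e' (u : S + T) : 'I_(#|S| + #|T|) :=
  match u with inl x => lshift _ (enum_rank x) | inr x => rshift _ (enum_rank x) end.
rewrite (@fdetE _ _ e).
  congr (\det _); apply/matrixP=> i j.
  rewrite /e !mxE; case: (split i) => i'; rewrite !mxE;
    by case: (split j) => j'; rewrite !mxE.
exists e' => [i|[x|x]]; rewrite /e /e'.
- by case: splitP => j ij; apply: val_inj; rewrite /= enum_valK.
- by rewrite -[lshift _ _]/(unsplit (inl _)) unsplitK enum_rankK.
- by rewrite -[rshift _ _]/(unsplit (inr _)) unsplitK enum_rankK.
Qed.

(* Schur complement, where [u] stands for the inverse of the lower right block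
   times the lower left one. *)
Lemma fdet_schur (S T : finType) (f : S + T -> S + T -> R) (u : T -> S -> R) :
  (forall y x, \sum_z f (inr y) (inr z) * u z x = f (inr y) (inl x)) ->
  fdet f = fdet (fun y z => f (inr y) (inr z)) *
    fdet (fun x w => f (inl x) (inl w) - \sum_z f (inl x) (inr z) * u z w).
Proof.
move=> fu; rewrite fdet_sum.
set A := fmx _; set B := fmx _; set C := fmx _; set D := fmx _.
pose U := fmx u.
have sumT F : \sum_z F z = \sum_(i < #|T|) F (enum_val i) :> R.
  by rewrite (reindex (fun i : 'I_#|T| => enum_val i)) //; exact/onW_bij/enum_val_bij.
(* A unipotent factor clears the lower left block without changing the determinant. *)
have -> : \det (block_mx A B C D)
    = \det (block_mx A B C D *m block_mx 1%:M 0 (- U) 1%:M).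
  by rewrite det_mulmx det_lblock !det1 !mulr1.
rewrite mulmx_block !mulmx1 !mulmx0 !add0r !mulmxN.
have -> : C - D *m U = 0.
  apply/matrixP=> i j; rewrite !mxE -fu sumT.
  by apply/eqP; rewrite subr_eq0; apply/eqP/eq_bigr => z _; rewrite !mxE.
rewrite det_ublock mulrC; congr (_ * \det _).
apply/matrixP=> i j; rewrite !mxE; congr (_ - _).
rewrite sumT.
by apply: eq_bigr => z _; rewrite !mxE.
Qed.

Lemma fdet_diag (T : finType) (a : R) :
  fdet (fun x y : T => (x == y)%:R * a) = a ^+ #|T|.
Proof.
rewrite -det_scalar; congr (\det _); apply/matrixP=> i j.
by rewrite !mxE (inj_eq enum_val_inj) mulr_natl.
Qed.

End IndexedDeterminant.

(** Matrix determinant lemma: [g] borders [f] by a column [c] and a row of ones, and is expanded by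
    both of its Schur complements. Constant row sums make the constant [c / a] the solution needed
    for the second. *)
Lemma fdet_sub_const (F : fieldType) (T : finType) (f : T -> T -> F) (a c : F) :
  a != 0 -> (forall x, \sum_y f x y = a) ->
  fdet (fun x y => f x y - c) = fdet f * (1 - #|T|%:R * c / a).
Proof.
move=> a0 fa.
pose g (u v : T + unit) : F :=
  match u, v with
  | inl x, inl y => f x y | inl _, inr _ => c | inr _, _ => 1
  end.
have <- : fdet g = fdet (fun x y => f x y - c).
  rewrite (@fdet_schur _ _ _ g (fun _ _ => 1)) => [|y x]; last first.
    by rewrite (big_pred1 tt) ?mulr1 // => -[].
  rewrite fdet_unit mul1r; apply: eq_fdet => x y /=.
  by rewrite (big_pred1 tt) ?mulr1 // => -[].
(* Swapping the summands makes [f] the eliminated block. *)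
pose h (u : unit + T) : T + unit := match u with inl z => inr z | inr x => inl x end.
rewrite -(@fdet_reindex _ _ _ h); last first.
  by exists (fun u => match u with inl z => inr z | inr x => inl x end) => [[]|[]].
rewrite (@fdet_schur _ _ _ _ (fun _ _ => c / a)) => [|y x] /=; last first.
  by rewrite -mulr_suml fa mulrC divfK.
rewrite fdet_unit; congr (_ * (1 - _)).
by rewrite -mulr_suml sumr_const mulrA.
Qed.

(** * Incidence and the Laplacian *)

Section Incidence.
Variables (R : pzSemiRingType) (G : sgraph).
Implicit Types (x y : G) (e : edge_type G).

Lemma sum_mem (T : finType) (A : {set T}) :
  \sum_x (x \in A)%:R = #|A|%:R :> R.
Proof.
rewrite -sum1_card natr_sum [RHS]big_mkcond /=.
by apply: eq_bigr => y _; case: ifP.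
Qed.

Lemma sum_const_card (T : finType) (c : R) : \sum_(x : T) c = #|T|%:R * c.
Proof. by rewrite sumr_const mulr_natl. Qed.

Lemma degreeE x : (degree x)%:R = \sum_y (sedge x y)%:R :> R.
Proof. by rewrite /degree -sum_mem; apply: eq_bigr => y _; rewrite inE. Qed.

Lemma sedge_neq x y : sedge x y -> x != y.
Proof. by apply: contraTneq => ->; rewrite sedge_irr. Qed.

Lemma card_edge e : #|val e| = 2%N.
Proof.
case: e => A /= /imsetP[[x y] /=]; rewrite inE /= => /sedge_neq xy ->.
by rewrite cards2 xy.
Qed.

Lemma edges_atE x :
  [set A in edges G | x \in A] = [set [set x; y] | y in [set y | sedge x y]].
Proof.
apply/setP=> A; rewrite inE; apply/andP/imsetP.
  case=> /imsetP[[u v] /=]; rewrite inE /= => uv ->.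
  rewrite !inE => /orP[] /eqP->; first by exists v; rewrite ?inE.
  by exists u; rewrite ?inE 1?sedge_sym // setUC.
case=> y; rewrite inE => xy ->; rewrite !inE eqxx; split=> //.
by apply/imsetP; exists (x, y); rewrite ?inE.
Qed.

(** This is [B B^T = D + A]: the edges at [x] correspond to its neighbours [z], and [{x, z}]
    contains [y] exactly when [y] is [x] or [z]. *)
Lemma incidence_gram x y :
  \sum_(e : edge_type G) (x \in val e)%:R * (y \in val e)%:R
    = (x == y)%:R * (degree x)%:R + (sedge x y)%:R :> R.
Proof.
transitivity (\sum_(A in edges G) (x \in A)%:R * (y \in A)%:R : R).
  by rewrite [RHS]big_sub.
transitivity (\sum_(A in [set A in edges G | x \in A]) (y \in A)%:R : R).
  rewrite [RHS]big_mkcond [LHS]big_mkcond /=; apply: eq_bigr => A _.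
  by rewrite inE; case: (A \in _) => //=; case: (x \in A); rewrite ?mul1r ?mul0r.
rewrite edges_atE big_imset /=; last first.
  move=> z w; rewrite !inE => /sedge_neq xz /sedge_neq _ /setP/(_ z).
  by rewrite !inE eqxx orbT eq_sym (negPf xz) => /esym/eqP.
have [<-|xy] := eqVneq x y.
  rewrite sedge_irr addr0 mul1r /degree -sum1_card natr_sum.
  by apply: eq_bigr => z _; rewrite !inE eqxx.
rewrite mul0r add0r [LHS]big_mkcond (bigD1 y) //= big1 => [|z zy].
  by rewrite !inE eqxx orbT addr0; case: sedge.
by case: ifP => // _; rewrite !inE eq_sym (negPf xy) eq_sym (negPf zy).
Qed.

Lemma sum_incident x : \sum_(e : edge_type G) (x \in val e)%:R = (degree x)%:R :> R.
Proof.
have := incidence_gram x x; rewrite eqxx mul1r sedge_irr addr0 => <-.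
by apply: eq_bigr => e _; case: (x \in _); rewrite ?mul1r ?mul0r.
Qed.

Lemma card_edge_type : #|edge_type G| = #|edges G|.
Proof. by rewrite card_sig; apply: eq_card => A. Qed.

(** Incidences are counted by vertices and by edges. *)
Lemma handshake k : regular G k -> #|G|%:R * k%:R = 2 * #|edges G|%:R :> R.
Proof.
move=> reg_k; rewrite -card_edge_type.
transitivity (\sum_(x : G) \sum_(e : edge_type G) (x \in val e)%:R : R).
  under eq_bigr do rewrite sum_incident reg_k.
  by rewrite sumr_const mulr_natl.
rewrite exchange_big /=.
under eq_bigr do rewrite sum_mem card_edge.
by rewrite sumr_const mulr_natr.
Qed.

End Incidence.

(** * Laplacian pencils and bounds on Laplacian eigenvalues *)

Section LaplacianDeterminant.
Variable R : comNzRingType.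

(** The entries of [x I - L(H)]. The extra degree that a vertex of [G1] or [G2] acquires in the join
    merely shifts [x]. *)
Definition lap_pencil (H : sgraph) (x : R) (u v : H) : R :=
  (u == v)%:R * (x - (degree u)%:R) + (sedge u v)%:R.

Lemma lap_pencil_sum (H : sgraph) x (u : H) : \sum_v lap_pencil x u v = x.
Proof.
rewrite big_split /= -degreeE (bigD1 u) //= eqxx mul1r big1 ?addr0 ?subrK //.
by move=> v vu; rewrite eq_sym (negPf vu) mul0r.
Qed.
End LaplacianDeterminant.

Lemma fdetZ (R : comPzRingType) (T : finType) (a : R) (f : T -> T -> R) :
  fdet (fun x y => a * f x y) = a ^+ #|T| * fdet f.
Proof. by rewrite -detZ; congr (\det _); apply/matrixP=> i j; rewrite !mxE. Qed.

Lemma horner_char_poly (R : comNzRingType) N (A : 'M[R]_N) x :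
  (char_poly A).[x] = \det (x%:M - A).
Proof.
rewrite -[LHS]/(horner_eval x (char_poly A)) -det_map_mx /char_poly_mx.
congr (\det _).
apply/matrixP=> i j; rewrite !mxE /= /horner_eval.
by rewrite hornerD hornerN hornerMn hornerX hornerC.
Qed.

Section LaplacianSpectrum.
Variable R : rcfType.
Implicit Type H : sgraph.

Lemma horner_char_laplacian H (x : R) :
  (char_poly (laplacian R H)).[x] = fdet (@lap_pencil R H x).
Proof.
rewrite horner_char_poly; congr (\det _); apply/matrixP=> i j.
rewrite !mxE /lap_pencil (inj_eq enum_val_inj).
by case: eqP => [->|_]; rewrite /= ?mulr1n ?mulr0n ?mul1r ?mul0r; ring.
Qed.

Lemma laplacian_sym H : (laplacian R H)^T = laplacian R H.
Proof.
apply/matrixP=> i j; rewrite !mxE sedge_sym.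
by congr (_ - _); have [->|] := eqVneq j i; rewrite // eq_sym => /negPf->.
Qed.

Lemma char_laplacian H :
  char_poly (laplacian R H) = \prod_(x <- lap_spectrum R H) ('X - x%:P).
Proof. exact/char_poly_symmetric/laplacian_sym. Qed.

Lemma size_lap_spectrum H : size (lap_spectrum R H) = #|H|.
Proof.
have := size_char_poly (laplacian R H).
by rewrite char_laplacian size_prod_XsubC => -[].
Qed.

(* [s = 1] gives the Laplacian form and [s = - 1] the signless one. *)
Lemma edge_form_ge0 H (s : R) (v : H -> R) : s ^+ 2 = 1 ->
  0 <= \sum_x \sum_y (sedge x y)%:R * (v y ^+ 2 - s * v x * v y).
Proof.
move=> s2; rewrite -(pmulr_rge0 _ (ltr0n R 2)).
set q := \sum_x _.
(* Symmetrizing in [x] and [y] gives squares, since [s ^+ 2 = 1]. *)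
suff -> : 2 * q = \sum_x \sum_y (sedge x y)%:R * (v y - s * v x) ^+ 2.
  by do 2!apply: sumr_ge0 => ? _; rewrite mulr_ge0 ?ler0n ?sqr_ge0.
have qE : q = \sum_x \sum_y (sedge x y)%:R * (v x ^+ 2 - s * v x * v y).
  rewrite /q exchange_big /=; apply: eq_bigr => x _; apply: eq_bigr => y _.
  by rewrite sedge_sym; ring.
rewrite mulr2n mulrDl mul1r {2}qE -big_split; apply: eq_bigr => x _.
rewrite -big_split; apply: eq_bigr => y _ /=.
by rewrite sqrrB exprMn s2; ring.
Qed.

(** Symmetry of adjacency turns the row eigenvector into an eigenfunction; its positive squared norm
    can be cancelled in Rayleigh quotients. *)
Lemma lap_eigenfunction H (x : R) : x \in lap_spectrum R H ->
  exists2 v : H -> R, 0 < \sum_y v y ^+ 2 &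
    forall y, (degree y)%:R * v y - \sum_z (sedge y z)%:R * v z = x * v y.
Proof.
rewrite -root_prod_XsubC -char_laplacian -eigenvalue_root_char.
case/eigenvalueP => w wL w0.
exists (fun y => w 0 (enum_rank y)).
  rewrite lt_def sumr_ge0 ?andbT => [|y _]; last exact: sqr_ge0.
  apply: contraNneq w0 => /psumr_eq0P w0.
  apply/eqP/rowP=> i; rewrite mxE -(enum_valK i); apply/eqP.
  by rewrite -sqrf_eq0 w0 // => y _; exact: sqr_ge0.
move=> y; have /rowP/(_ (enum_rank y)) := wL.
rewrite !mxE => <-.
under [RHS]eq_bigr do rewrite !mxE mulrBr.
rewrite sumrB; congr (_ - _).
  rewrite (bigD1 (enum_rank y)) /=; last by [].
  rewrite [X in _ + X]big1; last by move=> i /negPf->; rewrite mulr0n mulr0.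
  by rewrite addr0 eqxx mulr1n enum_rankK mulrC.
rewrite (reindex (fun i : 'I_#|H| => enum_val i)) /=; last exact/onW_bij/enum_val_bij.
by apply: eq_bigr => i _; rewrite enum_valK enum_rankK mulrC sedge_sym.
Qed.

Lemma lap_spectrum_ge0 H (x : R) : x \in lap_spectrum R H -> 0 <= x.
Proof.
case/lap_eigenfunction=> v v0 vL; rewrite -(pmulr_lge0 _ v0).
have := @edge_form_ge0 H 1 v (expr1n _ _); rewrite exchange_big /=.
congr (0 <= _); rewrite mulr_sumr; apply: eq_bigr => y _.
rewrite expr2 mulrA -vL mulrBl degreeE !mulr_suml -sumrB; apply: eq_bigr => z _.
by rewrite sedge_sym; ring.
Qed.

(** For a regular graph [2 k I - L = k I + A] is the signless Laplacian, which is positive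
    semidefinite. The bound makes the discriminants in (iii) nonnegative. *)
Lemma lap_spectrum_le H k (x : R) : regular H k ->
  x \in lap_spectrum R H -> x <= 2 * k%:R.
Proof.
move=> reg_k /lap_eigenfunction[v v0 vL].
rewrite -subr_ge0 -(pmulr_lge0 _ v0).
have s2 : (- 1) ^+ 2 = 1 :> R by rewrite sqrrN expr1n.
have := edge_form_ge0 v s2; rewrite exchange_big /=.
congr (0 <= _); rewrite mulr_sumr; apply: eq_bigr => y _.
have -> : (2 * k%:R - x) * v y ^+ 2
    = ((degree y)%:R * v y + \sum_z (sedge y z)%:R * v z) * v y.
  by rewrite expr2 mulrA mulrBl -vL reg_k; congr (_ * _); ring.
rewrite mulrDl degreeE !mulr_suml -big_split; apply: eq_bigr => z _ /=.
by rewrite sedge_sym; ring.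
Qed.

(** The all-ones vector is in the kernel, by the row sums of the pencil at [0], which is [- L]. *)
Lemma lap_spectrum0 H : (0 < #|H|)%N -> 0 \in lap_spectrum R H.
Proof.
move=> H_gt0; rewrite -root_prod_XsubC -char_laplacian -eigenvalue_root_char.
apply/eigenvalueP; exists (const_mx 1).
  rewrite scale0r -(trmx_const _ _ 1) -laplacian_sym -trmx_mul.
  apply/rowP=> i; rewrite !mxE.
  transitivity (- \sum_y @lap_pencil R H 0 (enum_val i) y); last first.
    by rewrite lap_pencil_sum oppr0.
  rewrite (reindex (fun i : 'I_#|H| => enum_val i)) /=; last exact/onW_bij/enum_val_bij.
  rewrite -sumrN; apply: eq_bigr => j _.
  rewrite !mxE /lap_pencil (inj_eq enum_val_inj) mulr1.
  by case: eqP => _; rewrite /= ?mulr1n ?mulr0n; ring.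
apply/eqP => /rowP/(_ (Ordinal H_gt0)); rewrite !mxE => /eqP.
by rewrite oner_eq0.
Qed.

(** Zero is an eigenvalue and none is negative, so the sorted list starts with it. *)
Lemma lap_spectrumE H : (0 < #|H|)%N ->
  lap_spectrum R H = 0 :: [seq lap_eig R H i | i <- index_iota 2 #|H|.+1].
Proof.
move=> H_gt0.
have s_sorted : sorted <=%R (lap_spectrum R H) by apply: sort_sorted; exact: le_total.
case sE : (lap_spectrum R H) (size_lap_spectrum H) => [|x s] sz.
  by rewrite -sz in H_gt0.
congr (_ :: _).
  apply/le_anti/andP; split.
    have := lap_spectrum0 H_gt0; rewrite sE inE => /orP[/eqP->//|].
    move: s_sorted; rewrite sE /= => /(order_path_min le_trans)/allP; exact.
  by apply: (@lap_spectrum_ge0 H); rewrite sE mem_head.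
apply: (@eq_from_nth _ 0) => [|i i_s].
  by rewrite size_map size_iota -sz /= subn2.
by rewrite (nth_map 0%N) ?nth_iota ?size_iota -?sz ?subn2 // /lap_eig sE.
Qed.

End LaplacianSpectrum.

(** * The characteristic polynomial of the double join *)

Section DoubleJoin.
Variables (F : fieldType) (G G1 G2 : sgraph) (k : nat).
Hypothesis reg_k : regular G k.
Let J := Rgraph_double_join G G1 G2.
Let n : F := #|G|%:R.
Let m : F := #|edges G|%:R.
Let n1 : F := #|G1|%:R.
Let n2 : F := #|G2|%:R.

Lemma degree_join_old (v : G) : (@degree J (inl (inl v)))%:R = 2 * k%:R + n1 :> F.
Proof.
rewrite degreeE !big_sumType /= -degreeE sum_incident !sum_const_card reg_k.
by rewrite /n1; ring.
Qed.

Lemma degree_join_new (e : edge_type G) :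
  (@degree J (inl (inr e)))%:R = 2 + n2 :> F.
Proof.
rewrite degreeE !big_sumType /= sum_mem card_edge !sum_const_card.
by rewrite /n2; ring.
Qed.

Lemma degree_join_left (y : G1) :
  (@degree J (inr (inl y)))%:R = (degree y)%:R + n :> F.
Proof.
rewrite !degreeE !big_sumType /= !sum_const_card.
by rewrite /n; ring.
Qed.

Lemma degree_join_right (y : G2) :
  (@degree J (inr (inr y)))%:R = (degree y)%:R + m :> F.
Proof.
rewrite !degreeE !big_sumType /= !sum_const_card card_edge_type.
by rewrite /m; ring.
Qed.

(** On I(G), [b] is the diagonal entry and [c] the constant subtracted when [G2] is eliminated.
    Eliminating I(G) subtracts [(k I + A) / b] and a constant on [G]; with [A = k I - L(G)] this
    leaves [a I - t L(G)], which is [t] times the pencil at [a / t], minus the constant [g]. *)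
Lemma fdet_join_pencil (x : F) :
  let b := x - n2 - 2 in
  let c := n2 / (x - m) in
  let a := x - k%:R - n1 - 2 * k%:R / b in
  let t : F := 1 - b^-1 in
  let g := n1 / (x - n) + c * k%:R ^+ 2 / (b * (b - m * c)) in
  x - n != 0 -> x - m != 0 -> b != 0 -> b - m * c != 0 -> a != 0 -> t != 0 ->
  fdet (@lap_pencil F J x) =
    fdet (@lap_pencil F G1 (x - n)) * fdet (@lap_pencil F G2 (x - m)) *
    ((b ^+ #|edges G| * (1 - m * c / b)) *
     (t ^+ #|G| * fdet (@lap_pencil F G (a / t)) * (1 - n * g / a))).
Proof.
move=> b c a t g xn xm b0 bc a0 t0.
(* The joining blocks are all ones, so each is solved by the reciprocal of the row sum. *)
pose u (y : G1 + G2) (w : G + edge_type G) : F :=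
  match y, w with
  | inl _, inl _ => (x - n)^-1
  | inr _, inr _ => (x - m)^-1
  | _, _ => 0
  end.
have outer1 (y z : G1) : @lap_pencil F J x (inr (inl y)) (inr (inl z))
    = lap_pencil (x - n) y z.
  by rewrite /lap_pencil degree_join_left /=; congr (_ * _ + _); ring.
have outer2 (y z : G2) : @lap_pencil F J x (inr (inr y)) (inr (inr z))
    = lap_pencil (x - m) y z.
  by rewrite /lap_pencil degree_join_right /=; congr (_ * _ + _); ring.
rewrite (@fdet_schur _ _ _ (@lap_pencil F J x) u); last first.
  case=> y [v|e]; rewrite big_sumType /=.
  - rewrite [X in _ + X]big1 => [|z _]; last by rewrite mulr0.
    under eq_bigr do rewrite outer1.
    by rewrite addr0 -mulr_suml lap_pencil_sum mulfV // /lap_pencil /= mul0r add0r.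
  - rewrite big1 => [|z _]; last by rewrite mulr0.
    rewrite big1 => [|z _]; last by rewrite /lap_pencil /= mul0r add0r mul0r.
    by rewrite /lap_pencil /= mul0r !add0r.
  - rewrite big1 => [|z _]; last by rewrite /lap_pencil /= mul0r add0r mul0r.
    rewrite big1 => [|z _]; last by rewrite mulr0.
    by rewrite /lap_pencil /= mul0r !add0r.
  - rewrite big1 => [|z _]; last by rewrite mulr0.
    under eq_bigr do rewrite outer2.
    by rewrite add0r -mulr_suml lap_pencil_sum mulfV // /lap_pencil /= mul0r add0r.
congr (_ * _).
  (* [G1] and [G2] are not adjacent, so the eliminated block is block diagonal. *)
  rewrite (@fdet_schur _ _ _ _ (fun _ _ => 0)) => [|y z]; last first.
    by rewrite big1 => [|w _]; rewrite ?mulr0 // /lap_pencil /= mul0r add0r.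
  rewrite mulrC; congr (_ * _); apply: eq_fdet => y z; last exact: outer2.
  by rewrite big1 ?subr0 => [|w _]; rewrite ?mulr0 // outer1.
pose h (w w' : G + edge_type G) : F :=
  match w, w' with
  | inl v, inl v' => (v == v')%:R * (x - (2 * k%:R + n1)) + (sedge v v')%:R - n1 / (x - n)
  | inl v, inr e | inr e, inl v => (v \in val e)%:R
  | inr e, inr e' => (e == e')%:R * b - c
  end.
rewrite (@eq_fdet _ _ _ h); last first.
  case=> [v|e] [v'|e']; rewrite big_sumType /=.
  - rewrite [X in _ - (_ + X)]big1 => [|z _]; last by rewrite mulr0.
    rewrite addr0 [in LHS]/lap_pencil /= degree_join_old.
    under eq_bigr do rewrite /lap_pencil /= mul0r add0r mul1r.
    by rewrite sum_const_card.
  - rewrite big1 => [|z _]; last by rewrite mulr0.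
    rewrite big1 => [|z _]; last by rewrite /lap_pencil /= mul0r add0r mul0r.
    by rewrite /lap_pencil /= mul0r !add0r subr0.
  - rewrite big1 => [|z _]; last by rewrite /lap_pencil /= mul0r add0r mul0r.
    rewrite big1 => [|z _]; last by rewrite mulr0.
    by rewrite /lap_pencil /= mul0r !add0r subr0.
  - rewrite big1 => [|z _]; last by rewrite mulr0.
    rewrite add0r [in LHS]/lap_pencil /= degree_join_new.
    under eq_bigr do rewrite /lap_pencil /= mul0r add0r mul1r.
    by rewrite sum_const_card addr0 /b opprD addrA addrAC.
(* Applying [b I - c J], with [J] all ones, to [B^T / b + d] gives [B^T - c k / b + d (b - m c)];
   this [d] cancels the constants. *)
pose d := c * k%:R / b / (b - m * c).
have sum_diag (T : finType) (x0 : T) (p q : T -> F) :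
    \sum_z ((x0 == z)%:R * p z) * q z = p x0 * q x0.
  rewrite (bigD1 x0) //= eqxx mul1r big1 ?addr0 // => z /negPf zx.
  by rewrite eq_sym zx !mul0r.
rewrite (@fdet_schur _ _ _ h (fun e v => (v \in val e)%:R / b + d)); last first.
  move=> e v /=.
  under eq_bigr do rewrite mulrBl.
  rewrite sumrB sum_diag -mulr_sumr big_split /= -mulr_suml sum_incident reg_k.
  rewrite sum_const_card card_edge_type -/m /d.
  by field; rewrite bc b0.
congr (_ * _).
  rewrite (fdet_sub_const _ b0) => [|e]; last first.
    by under eq_bigr do rewrite -[_ * b]mulr1; rewrite sum_diag mulr1.
  by rewrite fdet_diag card_edge_type.
rewrite -fdetZ -(fdet_sub_const _ a0) => [|v]; last first.
  by rewrite -mulr_sumr lap_pencil_sum mulrC divfK.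
apply: eq_fdet => v w /=.
under eq_bigr do rewrite mulrDr mulrA.
rewrite big_split /= -!mulr_suml incidence_gram sum_incident reg_k.
rewrite /lap_pencil reg_k /g /d /a.
rewrite (mulrDr t) (mulrCA t) (mulrBr t) (mulrC t (_ / t)) divfK // /t.
by field; rewrite b0 bc xn.
Qed.
End DoubleJoin.

(** * Comparing polynomials and extracting roots *)

Lemma poly_eq_large (R : realDomainType) (N : R) (p q : {poly R}) :
  (forall x, N < x -> p.[x] = q.[x]) -> p = q.
Proof.
move=> pq; apply/eqP; rewrite -subr_eq0; apply/eqP.
set d := p - q.
(* These are [size d] distinct zeros of [d], more than its degree allows unless [d = 0]. *)
pose rs := [seq N + i.+1%:R | i <- iota 0 (size d)].
apply: (@roots_geq_poly_eq0 _ _ rs); last by rewrite size_map size_iota.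
  apply/allP=> _ /mapP[i _ ->]; rewrite /root hornerD hornerN pq ?subrr //.
  by rewrite ltrDl ltr0Sn.
rewrite map_inj_uniq ?iota_uniq // => i j /addrI/eqP.
by rewrite eqr_nat => /eqP[].
Qed.

(** A monic divisor of a split polynomial splits. This yields the roots of the quartic without
    solving it. *)
Lemma split_cofactor (F : fieldType) (p : {poly F}) (s t : seq F) :
  (\prod_(x <- s) ('X - x%:P)) * p = \prod_(x <- t) ('X - x%:P) ->
  exists2 r : seq F, p = \prod_(x <- r) ('X - x%:P) & perm_eq t (s ++ r).
Proof.
move=> st.
have p_monic : p \is monic.
  by rewrite -(monicMl _ (monic_prod_XsubC s xpredT id)) st monic_prod_XsubC.
have p_dvd : p %| \prod_(x <- t) ('X - x%:P) by rewrite -st dvdp_mulIr.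
have [m] := dvdp_prod_XsubC p_dvd.
rewrite eqp_monic ?monic_prod_XsubC // => /eqP pE.
exists (mask m t) => //; apply: prod_XsubC_eq.
by rewrite big_cat /= -pE st.
Qed.

Lemma prodr_scale (R : comPzSemiRingType) (T : Type) (s : seq T) (f : T -> R) c :
  c ^+ size s * \prod_(y <- s) f y = \prod_(y <- s) (c * f y).
Proof.
elim: s => [|y s IHs]; first by rewrite !big_nil mulr1.
by rewrite !big_cons -IHs exprS mulrACA.
Qed.

Lemma horner_prod_XsubC (R : comNzRingType) (s : seq R) x :
  (\prod_(y <- s) ('X - y%:P)).[x] = \prod_(y <- s) (x - y).
Proof. by rewrite horner_prod; apply: eq_bigr => y _; rewrite hornerXsubC. Qed.

(** The left side collects the factors of the constant vectors on [G1], [G2], I(G) and [G]. *)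
Lemma quartic_factor (R : rcfType) (n m n1 n2 k x : R) :
  let b := x - n2 - 2 in
  let c := n2 / (x - m) in
  let a := x - k - n1 - 2 * k / b in
  let g := n1 / (x - n) + c * k ^+ 2 / (b * (b - m * c)) in
  n * k = 2 * m ->
  x - n != 0 -> x - m != 0 -> b != 0 -> b - m * c != 0 -> a != 0 ->
  (x - n) * (x - m) * b * (1 - m * c / b) * (a * (1 - n * g / a)) =
  x * (x ^+ 3 - (m + n + n1 + k + n2 + 2) * x ^+ 2
       + (2 * m + (n1 + k + n) * (m + n2 + 2) + n * k - 2 * k) * x
       + (2 * (n + m) * k - 2 * (n1 + k + n) * m - n * k * (m + n2 + 2))).
Proof.
move=> b c a g nk xn xm b0 bc a0.
have -> : a * (1 - n * g / a) = a - n * g by field.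
have bcE : b * (1 - m * c / b) = b - m * c by field.
(* Using [n k = 2 m] here lets the second fraction merge with [2 * k / b] into
   [2 * k / (b - m * c)]. *)
have -> : n * g = n * n1 / (x - n) + 2 * m * k * c / (b * (b - m * c)).
  by rewrite /g -nk; field; rewrite xn b0 bc.
have -> : a - (n * n1 / (x - n) + 2 * m * k * c / (b * (b - m * c)))
    = x - k - n1 - n * n1 / (x - n) - 2 * k / (b - m * c).
  by rewrite /a; field; rewrite xn b0 bc.
rewrite -(mulrA _ b) bcE.
transitivity (((x - m) * b - m * n2) * ((x - k - n1) * (x - n) - n * n1)
              - 2 * k * (x - m) * (x - n)).
  have -> : (x - m) * b - m * n2 = (x - m) * (b - m * c) by rewrite /c; field.
  by field; rewrite xn bc.
by rewrite /b; ring.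
Qed.

(** The truncated exponents on the two sides encode the signed multiplicity [m - n] of [n2 + 2]. The
    bound on [x] keeps every pivot nonzero. *)
Lemma join_char_poly (R : rcfType) (G G1 G2 : sgraph) (k : nat) (s s1 s2 : seq R) :
  (0 < #|G|)%N -> regular G k ->
  lap_spectrum R G = 0 :: s ->
  lap_spectrum R G1 = 0 :: s1 -> lap_spectrum R G2 = 0 :: s2 ->
  let n : R := #|G|%:R in let m : R := #|edges G|%:R in
  let n1 : R := #|G1|%:R in let n2 : R := #|G2|%:R in
  forall x : R, n + m + n1 + n2 + 3 * k%:R + 4 < x ->
  let q y := (x - n2 - 2) * (x - k%:R - n1 - y) - (2 * k%:R - y) in
  \prod_(y <- lap_spectrum R (Rgraph_double_join G G1 G2)) (x - y)
    * (x - n2 - 2) ^+ (#|G| - #|edges G|) =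
  \prod_(y <- s1) (x - (y + n)) * \prod_(y <- s2) (x - (y + m))
  * \prod_(y <- s) q y * (x - n2 - 2) ^+ (#|edges G| - #|G|)
  * (x * (x ^+ 3 - (m + n + n1 + k%:R + n2 + 2) * x ^+ 2
       + (2 * m + (n1 + k%:R + n) * (m + n2 + 2) + n * k%:R - 2 * k%:R) * x
       + (2 * (n + m) * k%:R - 2 * (n1 + k%:R + n) * m - n * k%:R * (m + n2 + 2)))).
Proof.
have rearrange (a b p r S1 S2 S B1 B2 B3 B4 u w : R) : B1 * B2 = b * B3 * B4 ->
    p * S1 * (r * S2) * (B1 * u * (a * S * w)) * B2
    = S1 * S2 * (B3 * S) * B4 * (p * r * b * u * (a * w)).
  move=> B12; transitivity (p * S1 * (r * S2) * (u * (a * S * w)) * (B1 * B2)).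
    by ring.
  by rewrite B12; ring.
move=> G_gt0 reg_k sE s1E s2E n m n1 n2 x x_big q.
have [n_ge0 m_ge0 n1_ge0 n2_ge0 k_ge0] :
    [/\ 0 <= n, 0 <= m, 0 <= n1, 0 <= n2 & 0 <= k%:R :> R].
  by rewrite !ler0n.
pose b := x - n2 - 2.
pose c : R := n2 / (x - m).
pose a := x - k%:R - n1 - 2 * k%:R / b.
pose t : R := 1 - b^-1.
have b_gt1 : 1 < b by rewrite /b; lra.
have b_gtm : m < b by rewrite /b; lra.
have b0 : b != 0 by rewrite gt_eqF //; lra.
have xn : x - n != 0 by rewrite gt_eqF //; lra.
have xm_gt : n2 < x - m by lra.
have xm : x - m != 0 by rewrite gt_eqF //; lra.
have c_lt1 : c < 1 by rewrite /c ltr_pdivrMr ?mul1r //; lra.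
have bc : b - m * c != 0.
  rewrite gt_eqF // subr_gt0; apply: le_lt_trans b_gtm.
  by rewrite ler_piMr // ltW.
have a0 : a != 0.
  rewrite gt_eqF // subr_gt0 ltr_pdivrMr; last by lra.
  have le_b : x - k%:R - n1 <= (x - k%:R - n1) * b by rewrite ler_peMr //; lra.
  by apply: lt_le_trans le_b; lra.
have t0 : t != 0.
  by rewrite gt_eqF // subr_gt0 invf_lt1 //; lra.
have size_s : size s = #|G|.-1 by rewrite -(size_lap_spectrum R G) sE.
have pencilE (H : sgraph) y :
    fdet (@lap_pencil R H y) = \prod_(z <- lap_spectrum R H) (y - z).
  by rewrite -horner_char_laplacian char_laplacian horner_prod_XsubC.
have shiftE (r : seq R) y :
    \prod_(z <- 0 :: r) (x - y - z) =
    (x - y) * \prod_(z <- r) (x - (z + y)).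
  by rewrite big_cons subr0; congr (_ * _); apply: eq_bigr => z _; ring.
pose g : R := n1 / (x - n) + c * k%:R ^+ 2 / (b * (b - m * c)).
have JE : fdet (@lap_pencil R (Rgraph_double_join G G1 G2) x) =
    fdet (@lap_pencil R G1 (x - n)) * fdet (@lap_pencil R G2 (x - m)) *
    ((b ^+ #|edges G| * (1 - m * c / b)) *
     (t ^+ #|G| * fdet (@lap_pencil R G (a / t)) * (1 - n * g / a))).
  exact: fdet_join_pencil.
rewrite !pencilE s1E s2E !shiftE in JE; rewrite {}JE -/b.
have -> : t ^+ #|G| * \prod_(z <- lap_spectrum R G) (a / t - z)
    = a * \prod_(z <- s) (a - t * z).
  rewrite -{1}(size_lap_spectrum R G) prodr_scale sE big_cons subr0 (mulrC t) divfK //.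
  by congr (_ * _); apply: eq_bigr => z _; rewrite mulrBr (mulrC t (_ / _)) divfK.
(* Each quadratic is [b * (a - t * y)]; its [b] comes from the determinant of I(G). *)
have qE : \prod_(y <- s) q y = b ^+ #|G|.-1 * \prod_(z <- s) (a - t * z).
  rewrite -size_s prodr_scale; apply: eq_bigr => y _.
  by rewrite /q /a /t -/b; field.
rewrite qE.
set Q := x * (x ^+ 3 - _ + _ + _).
have <- : (x - n) * (x - m) * b * (1 - m * c / b) * (a * (1 - n * g / a)) = Q.
  by apply: quartic_factor => //; exact: handshake.
(* Both sides have exponent [maxn #|G| #|edges G|]. *)
have bE : b ^+ #|edges G| * b ^+ (#|G| - #|edges G|)
    = b * b ^+ #|G|.-1 * b ^+ (#|edges G| - #|G|).
  by rewrite -exprS (prednK G_gt0) -!exprD -!maxnE maxnC.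
exact: rearrange bE.
Qed.

Theorem theorem7 (R : rcfType) (G G1 G2 : sgraph) (k n m n1 n2 : nat)
    (G_connected : connected G) (G_regular : regular G k)
    (G_order : #|G| = n) (G_size : #|edges G| = m)
    (G1_order : #|G1| = n1) (G2_order : #|G2| = n2)
    (n1_gt0 : (0 < n1)%N) (n2_gt0 : (0 < n2)%N) :
  let disc i := (n1%:R + lap_eig R G i + k%:R - n2%:R - 2) ^+ 2
                + 4 * (2 * k%:R - lap_eig R G i) in
  let trace i := n1%:R + lap_eig R G i + k%:R + n2%:R + 2 in
  let quartic : {poly R} :=
    'X * ('X^3
          - (m%:R + n%:R + n1%:R + k%:R + n2%:R + 2)%:P * 'X^2
          + (2 * m%:R + (n1%:R + k%:R + n%:R) * (m%:R + n2%:R + 2)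
             + n%:R * k%:R - 2 * k%:R)%:P * 'X
          + (2 * (n%:R + m%:R) * k%:R - 2 * (n1%:R + k%:R + n%:R) * m%:R
             - n%:R * k%:R * (m%:R + n2%:R + 2))%:P) in
  exists2 r : 4.-tuple R,
    quartic = \prod_(x <- r) ('X - x%:P) &
    (* "m - n times" is a signed multiplicity: for m < n (which happens only
       for G = K_1 or K_2) the value is removed n - m times. *)
    perm_eq (lap_spectrum R (Rgraph_double_join G G1 G2)
             ++ nseq (n - m) (n2%:R + 2))
      ([seq lap_eig R G1 i + n%:R | i <- index_iota 2 n1.+1]
       ++ [seq lap_eig R G2 i + m%:R | i <- index_iota 2 n2.+1]
       ++ [seq (trace i + Num.sqrt (disc i)) / 2 | i <- index_iota 2 n.+1]
       ++ [seq (trace i - Num.sqrt (disc i)) / 2 | i <- index_iota 2 n.+1]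
       ++ nseq (m - n) (n2%:R + 2)
       ++ r).
Proof.
subst n m n1 n2.
case: G_connected => G_gt0 _.
move=> disc trace quartic.
set J := Rgraph_double_join G G1 G2.
set l1 := map _ _; set l2 := map _ _; set lp := map _ _; set lm := map _ _.
set w : seq R := nseq (#|edges G| - #|G|) _.
set w' : seq R := nseq (#|G| - #|edges G|) _.
suff [r rE rP] : exists2 r : seq R, quartic = \prod_(x <- r) ('X - x%:P) &
    perm_eq (lap_spectrum R J ++ w') ((l1 ++ l2 ++ lp ++ lm ++ w) ++ r).
  (* The join has [n + m + n1 + n2] vertices, and the listed families leave exactly four
     eigenvalues. *)
  have size_r : size r == 4%N.
    have := perm_size rP.
    rewrite !size_cat !size_nseq !size_map !size_iota size_lap_spectrum.
    rewrite !card_sum card_edge_type => szE; apply/eqP.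
    move: #|edges G| #|G| #|G1| #|G2| (size r) szE G_gt0 n1_gt0 n2_gt0 => M N N1 N2 q.
    by clear; lia.
  by exists (Tuple size_r) => //=; rewrite -!catA in rP.
apply: split_cofactor; apply: (@poly_eq_large _
  (#|G|%:R + #|edges G|%:R + #|G1|%:R + #|G2|%:R + 3 * k%:R + 4)) => x x_big.
have := join_char_poly G_gt0 G_regular (lap_spectrumE R G_gt0)
  (lap_spectrumE R n1_gt0) (lap_spectrumE R n2_gt0) x_big.
rewrite hornerM !horner_prod_XsubC !big_cat /= !big_map !big_nseq !iter_mulr_1 => JE.
have quarticE : quartic.[x] = x * (x ^+ 3
    - (#|edges G|%:R + #|G|%:R + #|G1|%:R + k%:R + #|G2|%:R + 2) * x ^+ 2
    + (2 * #|edges G|%:R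
       + (#|G1|%:R + k%:R + #|G|%:R) * (#|edges G|%:R + #|G2|%:R + 2)
       + #|G|%:R * k%:R - 2 * k%:R) * x
    + (2 * (#|G|%:R + #|edges G|%:R) * k%:R
       - 2 * (#|G1|%:R + k%:R + #|G|%:R) * #|edges G|%:R
       - #|G|%:R * k%:R * (#|edges G|%:R + #|G2|%:R + 2))).
  by rewrite /quartic !(hornerM, hornerD, hornerN, hornerX, hornerXn, hornerC).
(* The two values for an index [j] are the roots of its quadratic, with sum [trace j] and product
   [(trace j ^+ 2 - disc j) / 4]. *)
have pairE : \prod_(2 <= j < #|G|.+1) (x - (trace j + Num.sqrt (disc j)) / 2)
    * \prod_(2 <= j < #|G|.+1) (x - (trace j - Num.sqrt (disc j)) / 2)
    = \prod_(2 <= j < #|G|.+1)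
        ((x - #|G2|%:R - 2) * (x - k%:R - #|G1|%:R - lap_eig R G j)
         - (2 * k%:R - lap_eig R G j)).
  rewrite -big_split; apply: eq_big_seq => j j_in /=.
  have j_eig : lap_eig R G j \in lap_spectrum R G.
    by rewrite (lap_spectrumE R G_gt0) inE map_f ?orbT.
  (* [Num.sqrt] is [0] on negative numbers, so its square is [disc j] only with this sign. *)
  have disc_ge0 : 0 <= disc j.
    rewrite addr_ge0 ?sqr_ge0 // mulr_ge0 ?ler0n // subr_ge0.
    exact: lap_spectrum_le G_regular j_eig.
  transitivity (x ^+ 2 - trace j * x + (trace j ^+ 2 - Num.sqrt (disc j) ^+ 2) / 4).
    by field.
  by rewrite sqr_sqrtr // /trace /disc; field.
rewrite quarticE !(opprD #|G2|%:R) !(addrA x) JE -pairE.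
by rewrite !mulrA.
Qed.
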